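(* Let $X$ be a finite-dimensional real vector space, let $f_1,f_2:X\to X$ be smooth, and let $F:X\times X\to X$ be the additive partition $F(y_1,y_2)=f_1(y_1)+f_2(y_2)$. Then for every color-branching edge-colored rooted tree $\tau$ (with edge colors in $\{1,2\}$), the elementary differential vanishes: $\mathcal{F}(\tau)(y)=0$ for all $y\in X$.
   Context: **Edge-colored rooted trees.** These are finite rooted trees in which each edge has a color in $\{1,2\}$. Recursively: the single node $\bullet$ is a tree, and if $\tau_1,\dots,\tau_m$ ($m\ge1$) are trees and $a_1,\dots,a_m\in\{1,2\}$, then $\tau=[\tau_1|_{a_1},\dots,\tau_m|_{a_m}]$ is the tree obtained by joining the root of each $\tau_l$ to a new root by an edge of color $a_l$; the order in which the pairs $(\tau_l,a_l)$ are listed is irrelevant. **Color-branching.** A node branches if it connects to at least two nodes above it (i.e. it has at least two children). An edge-colored rooted tree is color-branching if it contains a node that branches with at least two edges of different colors, i.e. a node having two edges to its children with different colors. **Elementary differentials.** For smooth $F:X\times X\to X$, define recursively $\mathcal{F}(\bullet)(y)=F(y,y)$ and $$\mathcal{F}(\tau)(y)=D_{a_1\dots a_m}F(y,y)[\mathcal{F}(\tau_1)(y),\dots,\mathcal{F}(\tau_m)(y)]\quad\text{for }\tau=[\tau_1|_{a_1},\dots,\tau_m|_{a_m}],$$ where $D_{a_1\dots a_m}F(y,y):X\times\dots\times X\to X$ is the $m$-multilinear map given by the $m$-th partial derivative of $F$ at $(y,y)$ with respect to its $a_1$-th, ..., $a_m$-th arguments. *)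

(* Defs.v *)
From HB Require Import structures.
From mathcomp Require Import all_boot all_order all_algebra.
From mathcomp Require Import all_classical all_reals all_analysis.

Set Implicit Arguments.
Unset Strict Implicit.
Unset Printing Implicit Defensive.

Import Order.TTheory GRing.Theory Num.Theory.
Import numFieldNormedType.Exports.

Local Open Scope ring_scope.

(* In finite dimension all norms are equivalent, so the norm carried by X does
   not affect which maps are differentiable, nor their differentials. *)
#[short(type="finNormedModType")]
HB.structure Definition FinNormedModule (K : numDomainType) :=
  {X of NormedModule K X & Vector K X}.

Section Smooth.
Variables (R : realType) (X Y : normedModType R).

Fixpoint iter_diff (f : X -> Y) (vs : seq X) : X -> Y :=
  if vs is v :: vs' then fun x => 'd (iter_diff f vs') x v else f.

(* C^infinity for finite-dimensional X: a map into multilinear maps is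
   differentiable iff its value on each tuple of vectors is, so the k-th
   Frechet derivative of f is differentiable iff all the maps
   x |-> D^k f(x)[v_1, ..., v_k] are; differentiability at every order also
   gives continuity at every order. *)
Definition smooth (f : X -> Y) : Prop :=
  forall (vs : seq X) (x : X), differentiable (iter_diff f vs) x.

End Smooth.

Variant color := Color1 | Color2.

(* Node [:: (a_1, t_1); ...; (a_m, t_m)] is [t_1|_{a_1}, ..., t_m|_{a_m}], and
   Node [::] is the single node.  A term is one listing of an unordered tree:
   listings that differ by permutations of children denote the same tree. *)
Inductive ectree := Node of seq (color * ectree).

Definition children (t : ectree) : seq (color * ectree) :=
  let: Node cs := t in cs.

(* Nodes of a tree are represented by the full subtrees they root. *)
Inductive has_node : ectree -> ectree -> Prop :=
| has_node_root t : has_node t t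
| has_node_above t i a u n :
    onth (children t) i = Some (a, u) -> has_node u n -> has_node t n.

Definition branches_with_two_colors (n : ectree) : Prop :=
  exists i j a b u w, [/\ onth (children n) i = Some (a, u),
                          onth (children n) j = Some (b, w) & a <> b].

Definition color_branching (t : ectree) : Prop :=
  exists2 n, has_node t n & branches_with_two_colors n.

Section ElementaryDifferential.
Variables (R : realType) (X : normedModType R).

Definition partial (a : color) (G : X * X -> X) (v : X) (p : X * X) : X :=
  match a with
  | Color1 => 'd (fun z => G (z, p.2)) (p.1) v
  | Color2 => 'd (fun z => G (p.1, z)) (p.2) v
  end.

(* iter_partial F [:: (a_1, v_1); ...; (a_m, v_m)] p is
   D_{a_1 ... a_m} F(p)[v_1, ..., v_m]. *)
Fixpoint iter_partial (F : X * X -> X) (avs : seq (color * X)) : X * X -> X :=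
  if avs is (a, v) :: avs' then partial a (iter_partial F avs') v else F.

Fixpoint elem_diff (F : X * X -> X) (t : ectree) (y : X) : X :=
  let: Node cs := t in
  iter_partial F [seq (c.1, elem_diff F c.2 y) | c <- cs] (y, y).

End ElementaryDifferential.

Definition additive_partition (R : realType) (X : normedModType R)
  (f1 f2 : X -> X) : X * X -> X := fun p => f1 p.1 + f2 p.2.

(* Main.v *)
Require Import Defs.
From HB Require Import structures.
From mathcomp Require Import all_boot all_order all_algebra.
From mathcomp Require Import all_classical all_reals all_analysis.
Import GRing.Theory numFieldNormedType.Exports.
Local Open Scope ring_scope.

(** Each term of [f1 y1 + f2 y2] depends on one argument only, so all mixed
    partial derivatives of the sum vanish: a partial derivative along a list of
    coloured directions is the iterated differential of [f1] in [y1] when all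
    colours are 1, plus that of [f2] in [y2] when all colours are 2
    ([iter_partial_additive_partition]).  Hence the elementary differential of
    a tree whose root has children of both colours is zero
    ([iter_partial_two_colors]).  If the bichromatic branching occurs higher up,
    the zero propagates down to the root, because an iterated partial
    derivative vanishes as soon as one of its directions is zero
    ([iter_partial_dir0]). *)

Definition same_color (a b : color) : bool :=
  match a, b with
  | Color1, Color1 | Color2, Color2 => true
  | _, _ => false
  end.

Lemma same_colorP (a b : color) : reflect (a = b) (same_color a b).
Proof. by case: a b => [] []; constructor. Qed.

Definition monochromatic (a : color) {V : Type} (avs : seq (color * V)) : bool :=
  all (fun c => same_color a c.1) avs.

Lemma monochromaticF {a b : color} {V : Type} {v : V} {avs : seq (color * V)}
    {i : nat} :
  onth avs i = Some (b, v) -> a <> b -> monochromatic a avs = false.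
Proof.
move=> + /same_colorP/negbTE nab.
elim: avs i => [|c avs IH] [|i] //=; first by case=> ->; rewrite /= nab.
by move=> /IH ->; rewrite andbF.
Qed.

Section IteratedPartials.
Context {R : realType} {X : normedModType R}.

Lemma diff_addr_cst (f : X -> X) (c v x : X) :
  differentiable f x -> 'd (fun z => f z + c) x v = 'd f x v.
Proof.
move=> df; have -> : (fun z => f z + c) = f + cst c by [].
by rewrite diffD //= diff_cst addr0.
Qed.

Lemma partial_cst0 (a : color) (v : X) (p : X * X) :
  partial a (fun=> 0 : X) v p = 0.
Proof. by case: a; rewrite /partial -/(cst 0) diff_cst. Qed.

(** By linearity of the differential at the zero direction itself; the
    derivatives taken afterwards are then those of the zero function. *)
Lemma iter_partial_dir0 {F : X * X -> X} {avs : seq (color * X)} {a : color}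
    {i : nat} (p : X * X) :
  onth avs i = Some (a, 0) -> iter_partial F avs p = 0.
Proof.
elim: avs i p => [|[b v] avs IH] [|i] p //=.
  by case=> _ ->; case: b; rewrite /partial linear0.
move=> /IH avs0; have -> : iter_partial F avs = fun=> 0 by exact/funext.
exact: partial_cst0.
Qed.

Definition pure_diff (a : color) (f : X -> X) (avs : seq (color * X)) (x : X) :
    X :=
  if monochromatic a avs then iter_diff f [seq c.2 | c <- avs] x else 0.

Lemma differentiable_pure_diff (a : color) (f : X -> X)
    (avs : seq (color * X)) (x : X) :
  smooth f -> differentiable (pure_diff a f avs) x.
Proof.
move=> smf; rewrite /pure_diff; case: monochromatic; first exact: smf.
exact: differentiable_cst.
Qed.

Lemma diff_pure_diff (a : color) (f : X -> X) (avs : seq (color * X))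
    (v x : X) :
  'd (pure_diff a f avs) x v = pure_diff a f ((a, v) :: avs) x.
Proof.
rewrite /pure_diff /=; have -> : same_color a a by case: a.
by case: monochromatic => //=; rewrite -/(cst 0) diff_cst.
Qed.

(** For the empty list both terms survive and give back [f1 p.1 + f2 p.2]; for
    any other list at most one does.  Keeping both terms lets one induction
    treat pure and mixed derivatives together. *)
Lemma iter_partial_additive_partition (f1 f2 : X -> X)
    (avs : seq (color * X)) (p : X * X) :
  smooth f1 -> smooth f2 ->
  iter_partial (additive_partition f1 f2) avs p =
  pure_diff Color1 f1 avs p.1 + pure_diff Color2 f2 avs p.2.
Proof.
move=> sm1 sm2; elim: avs p => [//|[a v] avs IH] p /=.
have -> : iter_partial (additive_partition f1 f2) avs = fun q =>
    pure_diff Color1 f1 avs q.1 + pure_diff Color2 f2 avs q.2 by exact/funext.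
case: a; rewrite /partial /=.
  rewrite diff_addr_cst ?diff_pure_diff; last exact: differentiable_pure_diff.
  by rewrite [X in _ + X]/pure_diff /= addr0.
under [X in 'd X _]funext => z do rewrite addrC.
rewrite diff_addr_cst ?diff_pure_diff; last exact: differentiable_pure_diff.
by rewrite [X in X + _]/pure_diff /= add0r.
Qed.

Lemma iter_partial_two_colors {f1 f2 : X -> X} {avs : seq (color * X)}
    {i j : nat} {a b : color} {v w : X} (p : X * X) :
  smooth f1 -> smooth f2 ->
  onth avs i = Some (a, v) -> onth avs j = Some (b, w) -> a <> b ->
  iter_partial (additive_partition f1 f2) avs p = 0.
Proof.
move=> sm1 sm2 avsi avsj nab.
have mixed c : monochromatic c avs = false.
  have [eca|/same_colorP nca] := boolP (same_color c a).
    by apply: monochromaticF avsj _; rewrite (same_colorP _ _ eca).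
  exact: monochromaticF avsi nca.
by rewrite iter_partial_additive_partition // /pure_diff !mixed addr0.
Qed.

End IteratedPartials.

Theorem proposition4p2 (R : realType) (X : finNormedModType R)
    (f1 f2 : X -> X) (hf1 : smooth f1) (hf2 : smooth f2)
    (t : ectree) (ht : color_branching t) (y : X) :
  elem_diff (additive_partition f1 f2) t y = 0.
Proof.
case: ht => n t_n; elim: t_n => {t n} [[cs]|[cs] i a u n csi _ IH] br /=.
  case: br => i [j] [a] [b] [u] [w] [/= csi csj nab].
  by apply: (iter_partial_two_colors (i := i) (j := j) _ hf1 hf2 _ _ nab);
    rewrite onth_map ?csi ?csj.
by apply: (iter_partial_dir0 (a := a) (i := i)); rewrite onth_map csi /= IH.
Qed.
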